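(* Let $y\in L^1_{\mathrm{loc}}[0,+\infty)$ be a nonnegative function (defined at every point of $[0,+\infty)$) and let $K>0$. Assume that, for almost every $s\ge0$ and for every $t\ge s$, $$y(t)\le y(s)-K\int_s^t y(\xi)\,d\xi,$$ and assume, additionally, that this inequality holds for $s=0$ (and every $t\ge0$). Then $$y(t)\le y(0)\,e^{-Kt}\quad\text{for all } t\ge0.$$ *)

(* Defs.v *)
From HB Require Import structures.
From mathcomp Require Import all_boot all_order all_algebra.
From mathcomp Require Import all_classical all_reals all_analysis.
Set Implicit Arguments.
Unset Strict Implicit.
Unset Printing Implicit Defensive.
Import Order.TTheory GRing.Theory Num.Theory.
Import numFieldNormedType.Exports.

Local Open Scope classical_set_scope.
Local Open Scope ring_scope.

(* [lebesgue_measure] lives on the Borel sigma-algebra.  The completed measure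
   is used so that L^1_loc ranges over all Lebesgue measurable functions:
   being defined at every point does not make a function Borel. *)
Notation leb R := (@completed_lebesgue_measure R).

(* L^1_loc(D), D not necessarily open, unlike [locally_integrable]: compact
   subsets of [0, +oo[ may contain the endpoint 0.  The values of f outside D
   are irrelevant. *)
Definition L1loc (R : realType) (D : set R) (f : R -> R) : Prop :=
  forall C : set R, C `<=` D -> compact C -> (leb R).-integrable C (EFin \o f).

(* Main.v *)
Require Import Defs.
From HB Require Import structures.
From mathcomp Require Import all_boot all_order all_algebra.
From mathcomp Require Import all_classical all_reals all_analysis.
From mathcomp Require Import ring lra.
Import Order.TTheory GRing.Theory Num.Theory.
Import numFieldNormedType.Exports.

Local Open Scope classical_set_scope.
Local Open Scope ring_scope.

(* If the inequality holds from s ("s is good"), then y(t) <= y(x) for almost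
   every x in [s, t] gives y(t) (1 + K (t - s)) <= y(s).  Since
   1 / (1 + x) = 1 - x / (1 + x) <= exp (- x / (1 + x)), this is exponential
   decay over [s, t] at any rate c <= K / (1 + K d) as soon as t - s <= d.
   Chaining such steps through good points, which are dense, starting from 0,
   gives decay at every rate c < K. *)

Lemma measurable_completed_itv (R : realType) (i : interval R) :
  ((wlength idfun)^*%mu).-cara.-measurable [set` i].
Proof. by apply: sub_caratheodory; exact: measurable_itv. Qed.

(** Both measures restrict the same outer measure, so the Borel formula carries over. *)
Lemma completed_lebesgue_measure_itv (R : realType) (i : interval R) :
  leb R [set` i] = (if i.1 < i.2 then (i.2 : \bar R) - i.1 else 0)%E.
Proof. exact: lebesgue_measure_itv. Qed.

(** Otherwise the null exceptional set would contain []a, b[], which has measure [b - a > 0]. *)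
Lemma ae_completed_lebesgue_itv {R : realType} {P : set R} {a b : R} :
  a < b -> {ae leb R, forall x, P x} -> exists2 x, a < x < b & P x.
Proof.
move=> ab [N [mN N0 PN]].
apply: contrapT => noP.
have abN : `]a, b[ `<=` N.
  move=> x /=; rewrite in_itv /= => axb; apply: PN => /= Px.
  by apply: noP; exists x.
have : (leb R `]a, b[ <= leb R N)%E.
  by apply: le_measure => //; rewrite inE //; exact: measurable_completed_itv.
rewrite N0 completed_lebesgue_measure_itv /= lte_fin ab -EFinB lee_fin.
by rewrite subr_le0 leNgt ab.
Qed.

Lemma ge_Rintegral_ae (R : realType) (y : R -> R) (m s t : R) :
  s <= t -> 0 <= m -> (forall x, s <= x <= t -> 0 <= y x) ->
  (leb R).-integrable `[s, t] (EFin \o y) ->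
  {ae leb R, forall x, s <= x <= t -> m <= y x} ->
  m * (t - s) <= \int[leb R]_(x in `[s, t]) y x.
Proof.
move=> st m0 y0 iy aey.
have mst := @measurable_completed_itv R `[s, t].
rewrite /Rintegral -lee_fin fineK; last exact: integrable_fin_num.
have -> : (m * (t - s))%:E = (\int[leb R]_(x in `[s, t]) (cst m%:E) x)%E.
  rewrite integral_cst //.
  rewrite [X in (_ * X)%E](completed_lebesgue_measure_itv _ `[s, t]) /= lte_fin.
  have [_|ts] := ltP s t; first by rewrite -EFinB EFinM.
  (* Degenerate interval: the constant has integral zero, as [t - s = 0]. *)
  have -> : s = t by lra.
  by rewrite subrr mule0 mulr0.
by apply: ae_ge0_le_integral => //; exact: measurable_int iy.
Qed.

Lemma inv1p_expR_le (R : realType) (c x : R) : 0 <= x -> c <= x / (1 + x) ->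
  (1 + x)^-1 <= expR (- c).
Proof.
move=> x0 cx; apply: le_trans (expR_ge1Dx _).
have -> : (1 + x)^-1 = 1 - x / (1 + x) by field; lra.
lra.
Qed.

Theorem propositionA1 (R : realType) (y : R -> R) (K : R)
  (y_loc : L1loc `[0, +oo[ y)
  (y_ge0 : forall t : R, 0 <= t -> 0 <= y t)
  (K_gt0 : 0 < K)
  (y_ae : {ae leb R, forall s : R, 0 <= s -> forall t : R, s <= t ->
    y t <= y s - K * \int[leb R]_(xi in `[s, t]) y xi})
  (y_0 : forall t : R, 0 <= t ->
    y t <= y 0 - K * \int[leb R]_(xi in `[0, t]) y xi) :
  forall t : R, 0 <= t -> y t <= y 0 * expR (- (K * t)).
Proof.
pose good s := forall t, s <= t ->
  y t <= y s - K * \int[leb R]_(xi in `[s, t]) y xi.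
have int_y s t : 0 <= s -> (leb R).-integrable `[s, t] (EFin \o y).
  move=> s0; apply: y_loc; last exact: segment_compact.
  by move=> x /=; rewrite !in_itv /= andbT => /andP[/(le_trans s0)].
have good_le s t : 0 <= s -> good s -> s <= t -> y t <= y s.
  move=> s0 gs st; apply: le_trans (gs t st) _.
  rewrite gerBl pmulr_rge0//; apply: Rintegral_ge0 => x /=.
  by rewrite in_itv /= => /andP[/(le_trans s0)/y_ge0].
have good_mul s t : 0 <= s -> good s -> s <= t ->
    y t * (1 + K * (t - s)) <= y s.
  move=> s0 gs st; have t0 := le_trans s0 st.
  rewrite mulrDr mulr1 -lerBrDr; apply: le_trans (gs t st) _.
  rewrite lerD2l lerN2 mulrCA ler_pM2l//; apply: ge_Rintegral_ae => //.
  + exact: y_ge0.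
  + by move=> x /andP[sx _]; apply/y_ge0/(le_trans s0).
  + exact: int_y.
  (* Outside the null set of [y_ae], a point [x] of [[s, t]] is good, so [good_le] from [x] to [t]
     gives [y t <= y x]. *)
  + case: y_ae => N [mN N0 PN]; exists N; split => // x /= H; apply: PN => /= H'.
    apply: H => /andP[sx xt]; apply: good_le => //; first exact: le_trans sx.
    by apply: H'; exact: le_trans sx.
have step d s t : good s -> 0 <= s -> s <= t <= s + d ->
    y t <= y s * expR (- (K / (1 + K * d) * (t - s))).
  move=> gs s0 /andP[st td].
  have h0 : 0 <= K * (t - s) by apply: mulr_ge0; lra.
  have hd : K * (t - s) <= K * d by rewrite ler_pM2l//; lra.
  apply: (@le_trans _ _ (y s * (1 + K * (t - s))^-1)).
    by rewrite ler_pdivlMr; [exact: good_mul|lra].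
  apply: ler_wpM2l; first exact: y_ge0.
  apply: inv1p_expR_le => //.
  (* Both fractions have numerator [K * (t - s)]; [hd] compares the denominators. *)
  rewrite mulrAC ler_wpM2l// lef_pV2 ?posrE; lra.
(* Steps have length below [d] but advance by more than [d / 2]: this slack leaves an open interval
   in which to pick a good point. *)
have chain d : 0 < d -> forall n t, 0 <= t <= n%:R * (d / 2) ->
    y t <= y 0 * expR (- (K / (1 + K * d) * t)).
  move=> d0; elim=> [|n IHn] t.
    rewrite mul0r => t0; have -> : t = 0 by lra.
    by rewrite mulr0 oppr0 expR0 mulr1.
  rewrite -natr1 => /andP[t0 tn].
  have [td|dt] := leP t d.
    (* A single step from 0, which is good by [y_0]. *)
    rewrite -{2}[t]subr0; apply: step => //; lra.
  have dlt : t - d < t - d / 2 by lra.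
  (* The lower bound on [s] makes [step] reach [t]; the upper bound makes the induction hypothesis
     apply at [s]. *)
  have [s /andP[ds sd] gs] := ae_completed_lebesgue_itv dlt y_ae.
  have s0 : 0 <= s by lra.
  apply: le_trans (step d s t (gs s0) s0 _) _; first lra.
  have -> : - (K / (1 + K * d) * t) =
      - (K / (1 + K * d) * s) + - (K / (1 + K * d) * (t - s)) by lra.
  rewrite expRD mulrA ler_wpM2r ?expR_ge0//; apply: IHn; lra.
move=> t t0.
have decay d : 0 < d -> y t <= y 0 * expR (- (K / (1 + K * d) * t)).
  move=> d0; have d2 : 0 < d / 2 by lra.
  apply: (chain d d0 (Num.bound (t / (d / 2)))).
  by rewrite t0 /= -ler_pdivrMr// ltW// archi_boundP// divr_ge0// ltW.
(* The rate [K / (1 + K * d)] tends to [K] as [d] decreases to 0, and the bounds [decay] pass to the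
   limit. *)
pose f d := y 0 * expR (- (K / (1 + K * d) * t)).
have f_cvg : f d @[d --> 0^'+] --> y 0 * expR (- (K * t)).
  have -> : y 0 * expR (- (K * t)) = f 0 by rewrite /f mulr0 addr0 divr1.
  apply: cvg_at_right_filter; apply: cvgM; first exact: cvg_cst.
  apply: continuous_cvg; first exact: continuous_expR.
  apply: cvgN; apply: cvgM; last exact: cvg_cst.
  apply: cvgM; first exact: cvg_cst.
  apply: cvgV; first by rewrite mulr0 addr0 oner_neq0.
  apply: cvgD; first exact: cvg_cst.
  by apply: cvgM; [exact: cvg_cst|exact: cvg_id].
apply: (cvgr_to_ge f_cvg); near=> d; apply: decay; near: d.
exact: nbhs_right_gt.
Unshelve. all: by end_near. Qed.
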